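(* Let $d \geq 2$ and $n \geq d$ be integers with $(d,n) \neq (2,2)$. Let $\psi : \mathbb{R}_{>0} \to \mathbb{R}_{>0}$ be a function such that $\psi(u) = o(u)$ as $u \to \infty$. Then \[ \lim_{A \to \infty} \frac{\# \{ V \in \mathbb{V}_{d,n}(A) : \mathfrak{M}(V) > \psi(\|\mathbf{a}_V\|) \}}{\# \mathbb{V}_{d,n}(A)} = 1. \]
   Context: For an integer $N \geq 1$, $\|\cdot\|$ denotes the Euclidean norm on $\mathbb{R}^N$, and $\mathbb{Z}^N_{\mathrm{prim}}$ denotes the set of $(c_1,\dots,c_N) \in \mathbb{Z}^N$ with $\gcd(c_1,\dots,c_N)=1$. Let $N_{d,n} = \binom{n+d}{d}$ be the number of monomials of degree $d$ in $n+1$ variables. Degree $d$ hypersurfaces in $\mathbb{P}^n$ defined over $\mathbb{Q}$ are parametrized (via their coefficient vectors, monomials listed in lexicographic order) by $\mathbb{V}_{d,n} = \mathbb{P}^{N_{d,n}-1}(\mathbb{Q})$. For $V \in \mathbb{V}_{d,n}$, $\mathbf{a}_V \in \mathbb{Z}^{N_{d,n}}_{\mathrm{prim}}$ denotes either of the two primitive coefficient vectors of $V$, and for $A \geq 1$, $\mathbb{V}_{d,n}(A) = \{V \in \mathbb{V}_{d,n} : \|\mathbf{a}_V\| \leq A\}$. For $x \in \mathbb{P}^n(\mathbb{Q})$, write $x = (x_0 : \dots : x_n)$ with $\mathbf{x} = (x_0,\dots,x_n) \in \mathbb{Z}^{n+1}_{\mathrm{prim}}$ and set $H(x) = \|\mathbf{x}\|^{n+1-d}$.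 For $V \in \mathbb{V}_{d,n}$, $\mathfrak{M}(V) = \min_{x \in V(\mathbb{Q})} H(x)$ if $V(\mathbb{Q}) \neq \emptyset$ and $\mathfrak{M}(V) = \infty$ otherwise. *)

(* Defs.v *)
From HB Require Import structures.
From mathcomp Require Import all_boot all_order all_algebra.
From mathcomp Require Import all_classical all_reals all_analysis.
Set Implicit Arguments. Unset Strict Implicit. Unset Printing Implicit Defensive.
Import Order.TTheory GRing.Theory Num.Theory.
Local Open Scope ring_scope.

Definition Mon (d n : nat) : predArgType :=
  {e : {ffun 'I_n.+1 -> 'I_d.+1} | (\sum_(i < n.+1) (e i : nat) == d)%N}.

Definition coefvec (d n : nat) := {ffun Mon d n -> int}.

Definition primitive_vec (I : finType) (a : {ffun I -> int}) : bool :=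
  \big[gcdz/0%Z]_(i : I) a i == 1%Z.

Definition enorm (R : realType) (I : finType) (a : {ffun I -> int}) : R :=
  Num.sqrt (\sum_(i : I) ((a i)%:~R) ^+ 2).

Definition form_eval (d n : nat) (a : coefvec d n) (x : {ffun 'I_n.+1 -> int}) : int :=
  \sum_(m : Mon d n) a m * \prod_(i < n.+1) x i ^+ (val m i : nat).

(* Height H(x) = ||x||^(n+1-d) of the point with primitive representative x. *)
Definition Hpt (R : realType) (d n : nat) (x : {ffun 'I_n.+1 -> int}) : R :=
  enorm R x ^+ (n.+1 - d).

(* M(V) = min of H over V(Q) (= inf, the min being attained), +oo if V(Q) is empty.
   Points of V(Q) are given by their primitive integer representatives x
   (x and -x give the same point and the same height). *)
Definition Mfrak (R : realType) (d n : nat) (a : coefvec d n) : \bar R :=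
  ereal_inf [set (Hpt R d x)%:E | x in
     [set x : {ffun 'I_n.+1 -> int} | primitive_vec x /\ form_eval a x = 0%Z]].

(* A point V of P^{N-1}(Q) is represented by the unique primitive a_V whose
   nonzero coordinate selected by [pick] (a choice depending only on the support,
   hence the same for a and -a) is positive. *)
Definition normalized (I : finType) (a : {ffun I -> int}) : bool :=
  if [pick i | a i != 0%Z] is Some i then (0 < a i)%R else false.

Definition is_hyp (d n : nat) (a : coefvec d n) : bool :=
  primitive_vec a && normalized a.

Definition box (d n k : nat) := {ffun Mon d n -> 'I_(2 * k).+1}.
Definition of_box (d n k : nat) (f : box d n k) : coefvec d n :=
  [ffun m => (f m : nat)%:Z - k%:Z].

(* #{V in V_{d,n}(A) : P V}; every a with ||a|| <= A has coordinates in
   [-truncn A, truncn A], and of_box is injective. *)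
Definition countV (R : realType) (d n : nat) (P : coefvec d n -> bool) (A : R) : nat :=
  #|[set f : box d n (Num.truncn A) |
      is_hyp (of_box f) && (enorm R (of_box f) <= A) && P (of_box f)]|.

(* Main.v *)
(** Height at most [psi(||a||) = o(A)] forces a zero [x] with [|x|^(n+1-d) <= eps A], so the
    proof is a union bound over such [x].

    The forms with coefficients bounded by [K] vanishing at a given primitive [x] with
    [|x|_oo = M <= K] are at most [C K^N / (K M^d)] in number.  Indeed every integer [t] with
    [|t| <= K M^d] is a value [f_b(x)] of a form with coefficients [O(K)] (Bezout, with remainders
    modulo the largest coordinate of [x], iterated over the degree), so that
    [(a, t) |-> a + b_t] is an injection into a box of size [O(K)].  As there are [O(M^n)]
    points [x] with [|x|_oo = M], summing over [M <= X] gives [O(X^(n+1-d) K^(N-1))] forms with a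
    zero in the box of size [X], that is [O(eps A^N)].  The total count is at least a positive
    multiple of [A^N], because a positive proportion of the vectors with positive coordinates is
    primitive: [sum_(g >= 2) g^-2 <= 3/4]. *)
Require Import Defs.
From HB Require Import structures.
From mathcomp Require Import all_boot all_order all_algebra.
From mathcomp Require Import all_classical all_reals all_analysis.
From mathcomp Require Import zify ring lra.
Set Implicit Arguments. Unset Strict Implicit. Unset Printing Implicit Defensive.
Import Order.TTheory GRing.Theory Num.Theory.
Import numFieldNormedType.Exports.
Local Open Scope classical_set_scope.
Local Open Scope ring_scope.

(** * Cubes of integer vectors *)

(** Uses the same shift as [of_box], so that [countV] becomes a count over a list of integer
    vectors; the index type is arbitrary because both coefficient vectors and points are counted. *)
Definition cube (I : finType) (k : nat) : seq {ffun I -> int} :=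
  [seq [ffun i => (f i : nat)%:Z - k%:Z] | f : {ffun I -> 'I_(2 * k).+1}].

Lemma mem_cube (I : finType) (k : nat) (a : {ffun I -> int}) :
  (a \in cube I k) = [forall i, (`|a i| <= k)%N].
Proof.
apply/mapP/forallP => [[f _ ->] i|ha].
  by rewrite ffunE; case: (f i) => m /=; lia.
exists [ffun i => inord (absz (a i + k%:Z))]; first by rewrite mem_enum.
apply/ffunP => i; rewrite !ffunE; move: (a i) (ha i) => z hz; rewrite inordK; lia.
Qed.

Lemma cube_uniq (I : finType) (k : nat) : uniq (cube I k).
Proof.
rewrite map_inj_uniq ?enum_uniq // => f g /ffunP fg.
by apply/ffunP => i; apply: val_inj => /=; have := fg i; rewrite !ffunE; lia.
Qed.

Lemma size_cube (I : finType) (k : nat) : size (cube I k) = ((2 * k).+1 ^ #|I|)%N.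
Proof. by rewrite size_map -cardE card_ffun card_ord. Qed.

Lemma countVE (R : realType) (d n : nat) (P : coefvec d n -> bool) (A : R) :
  countV P A = count (fun a => is_hyp a && (enorm R a <= A) && P a)
                 (cube (Mon d n) (Num.truncn A)).
Proof.
rewrite /countV cardsE cardE size_filter /cube [RHS]count_map enumT.
by apply: eq_count => f; rewrite /= unfold_in.
Qed.

(** * Representing integers as values of forms with small coefficients *)

(** The integer combinations of the coordinates contain 0 and every coordinate, and are closed under
    gcd by Bezout's identity for two integers. *)
Lemma primitive_bezout (I : finType) (x : {ffun I -> int}) :
  primitive_vec x -> exists c : I -> int, \sum_i c i * x i = 1.
Proof.
move=> /eqP x1; change (exists c : I -> int, \sum_i c i * x i = 1%Z); rewrite -x1.
apply: (big_ind (fun g : int => exists c : I -> int, \sum_i c i * x i = g)).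
- by exists (fun=> 0); rewrite big1 // => i _; rewrite mul0r.
- move=> _ _ [c <-] [c' <-]; have [u [v <-]] := Bezoutz (\sum_i c i * x i) (\sum_i c' i * x i).
  exists (fun i => u * c i + v * c' i); rewrite !mulr_sumr -big_split /=.
  by apply: eq_bigr => i _; ring.
- move=> j _; exists (fun i => (i == j)%:R); rewrite (bigD1 j) //= eqxx mul1r.
  by rewrite big1 ?addr0 // => i /negbTE ->; rewrite mul0r.
Qed.

Lemma primitive_neq0 (I : finType) (x : {ffun I -> int}) :
  primitive_vec x -> exists i, x i != 0.
Proof.
move=> /primitive_bezout [c c1]; apply/existsP; apply: contra_eqT c1.
rewrite negb_exists => /forallP x0.
by rewrite big1 // => i _; have /negPn/eqP -> := x0 i; rewrite mulr0.
Qed.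

Lemma absz_sum_le (I : finType) (P : pred I) (F : I -> int) :
  (`|(\sum_(i | P i) F i)%R| <= \sum_(i | P i) `|F i|)%N.
Proof.
apply: (big_rec2 (fun (u : int) (v : nat) => `|u| <= v)%N) => // i u v _.
lia.
Qed.

(** Scale a Bezout relation by [t], reduce each coefficient other than the one at [j] modulo [x j],
    and move the quotients into the coefficient [bj] of [x j]. The remainders are below
    [|x j| <= K]. Then [bj * x j] is [t] minus [n] terms of size at most [K * |x j|], which bounds
    [bj]. *)
Lemma linear_representation (n : nat) (x : {ffun 'I_n.+1 -> int}) (j : 'I_n.+1)
    (K : nat) (t : int) :
  primitive_vec x -> (forall i, `|x i| <= `|x j|)%N -> (`|x j| <= K)%N ->
  (`|t| <= K * `|x j|)%N ->
  exists2 b : 'I_n.+1 -> int, (forall i, `|b i| <= n.+1 * K)%N & \sum_i b i * x i = t.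
Proof.
move=> xP xj jK tK.
have xj0 : x j != 0.
  by have [i] := primitive_neq0 xP; rewrite -!absz_gt0 => /leq_trans; apply; exact: xj.
have [c c1] := primitive_bezout xP.
pose q i := (t * c i %/ x j)%Z; pose r i := (t * c i %% x j)%Z.
pose bj := t * c j + \sum_(i | i != j) q i * x i.
have rlt i : (`|r i| < `|x j|)%N.
  by have := modz_ge0 (t * c i) xj0; have := ltz_mod (t * c i) xj0; rewrite /r; lia.
have bjE : bj * x j = t - \sum_(i | i != j) r i * x i.
  rewrite -[in RHS](mulr1 t) -c1 (bigD1 j) //= mulrDr mulr_sumr -addrA -sumrB.
  rewrite mulrDl mulrA; congr (_ + _); rewrite mulr_suml; apply: eq_bigr => i _.
  by rewrite mulrA [in RHS](divz_eq (t * c i) (x j)) -/(q i) -/(r i); ring.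
exists (fun i => if i == j then bj else r i) => [i|].
  case: eqP => _; last by have := rlt i; nia.
  have : (`|bj| * `|x j| <= (n.+1 * K) * `|x j|)%N.
    rewrite -abszM bjE; apply: (@leq_trans (`|t| + n * (K * `|x j|))).
      set s := (X in t - X); suff : (`|s| <= n * (K * `|x j|))%N by lia.
      have -> : (n * (K * `|x j|) = \sum_(i | i != j) K * `|x j|)%N.
        by rewrite sum_nat_const cardC1 card_ord.
      apply: leq_trans (absz_sum_le _ _) _.
      by apply: leq_sum => k _; rewrite abszM leq_mul ?xj // (leq_trans (ltnW (rlt k))).
    nia.
  by rewrite leq_pmul2r //; lia.
rewrite (bigD1 j) //= eqxx bjE -[RHS](subrK (\sum_(i | i != j) r i * x i)).
by congr (_ + _); apply: eq_bigr => i /negbTE ->.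
Qed.

Lemma mon_mul_subproof (d n : nat) (m : Mon d n) (i : 'I_n.+1) :
  (\sum_(j < n.+1)
     ([ffun j => inord (val m j + (j == i))] : {ffun 'I_n.+1 -> 'I_d.+2}) j == d.+1)%N.
Proof.
rewrite (eq_bigr (fun j => val m j + (j == i)))%N; last first.
  by move=> j _; rewrite ffunE inordK //; have := ltn_ord (val m j); case: eqP => _; lia.
rewrite big_split /= (eqP (valP m)) (bigD1 i) //= eqxx big1 ?addn0 ?addn1 //.
by move=> j /negbTE ->.
Qed.

(** The monomial [m] times the variable of index [i]; [inord] never truncates, since the exponents
    of [m] are at most [d]. *)
Definition mon_mul (d n : nat) (m : Mon d n) (i : 'I_n.+1) : Mon d.+1 n :=
  @exist {ffun 'I_n.+1 -> 'I_d.+2} (fun e => \sum_(j < n.+1) (e j : nat) == d.+1)%N _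
    (mon_mul_subproof m i).

Lemma prod_mon_mul (d n : nat) (m : Mon d n) (i : 'I_n.+1) (x : {ffun 'I_n.+1 -> int}) :
  \prod_(j < n.+1) x j ^+ (val (mon_mul m i) j : nat)
  = x i * \prod_(j < n.+1) x j ^+ (val m j : nat).
Proof.
have -> : x i = \prod_(j < n.+1) x j ^+ (j == i).
  rewrite (bigD1 i) //= eqxx expr1 big1 ?mulr1 // => j /negbTE ->.
  by rewrite expr0.
rewrite -big_split /=; apply: eq_bigr => j _.
rewrite ffunE inordK; first by rewrite exprD; exact: mulrC.
by case: (sval m j) => k; case: eqP => _ /=; lia.
Qed.

(** The form [\sum_i X_i b_i]. Different pairs of [i] and [m'] may produce the same monomial, hence
    the double sum. *)
Definition linear_combination (d n : nat) (b : 'I_n.+1 -> coefvec d n) : coefvec d.+1 n :=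
  [ffun m => \sum_i \sum_m' (mon_mul m' i == m)%:R * b i m'].

Lemma form_eval_linear_combination (d n : nat) (b : 'I_n.+1 -> coefvec d n)
    (x : {ffun 'I_n.+1 -> int}) :
  form_eval (linear_combination b) x = \sum_i form_eval (b i) x * x i.
Proof.
rewrite /form_eval (eq_bigr (fun m => \sum_i \sum_m' 
  (mon_mul m' i == m)%:R * b i m' * \prod_(j < n.+1) x j ^+ (val m j : nat))); last first.
  by move=> m _; rewrite ffunE mulr_suml; apply: eq_bigr => i _; rewrite mulr_suml.
rewrite exchange_big /=; apply: eq_bigr => i _.
rewrite exchange_big /= mulr_suml; apply: eq_bigr => m' _.
rewrite (bigD1 (mon_mul m' i)) //= eqxx mul1r prod_mon_mul [X in _ + X]big1 ?addr0.
  by rewrite mulrCA; exact: mulrC.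
by move=> m; rewrite eq_sym => /negbTE ->; rewrite !mul0r.
Qed.

Lemma linear_combination_le (d n B : nat) (b : 'I_n.+1 -> coefvec d n) (m : Mon d.+1 n) :
  (forall i m', `|b i m'| <= B)%N ->
  (`|linear_combination b m| <= n.+1 * #|Mon d n| * B)%N.
Proof.
move=> bB; rewrite ffunE.
apply: leq_trans (absz_sum_le _ _) _.
rewrite -mulnA -[X in (_ <= X * _)%N]card_ord -sum_nat_const; apply: leq_sum => i _.
apply: leq_trans (absz_sum_le _ _) _.
rewrite -sum_nat_const; apply: leq_sum => m' _.
by rewrite abszM; case: eqP => _; rewrite ?mul0n // mul1n.
Qed.

Lemma card_Mon0 (n : nat) : #|Mon 0 n| = 1%N.
Proof.
have z : (\sum_(i < n.+1) ([ffun=> ord0] : {ffun 'I_n.+1 -> 'I_1}) i == 0)%N.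
  by rewrite big1 // => i _; rewrite ffunE.
have m0 : Mon 0 n :=
  @exist {ffun 'I_n.+1 -> 'I_1} (fun e => \sum_(i < n.+1) (e i : nat) == 0)%N _ z.
apply: etrans (card1 m0); apply: eq_card => m; rewrite !inE.
by apply/esym/eqP/val_inj/ffunP => i; rewrite [LHS]ord1 [RHS]ord1.
Qed.

(** Induction on the degree: the linear case with bound [K * |x j| ^ d] gives
    [t = \sum_i c i * x i], and each [c i] is the value of a form of degree [d] by the induction
    hypothesis with [n.+1 * K] in place of [K]. *)
Lemma form_representation (d n : nat) : exists C : nat,
  forall (x : {ffun 'I_n.+1 -> int}) (j : 'I_n.+1) (K : nat) (t : int),
  primitive_vec x -> (forall i, `|x i| <= `|x j|)%N -> (`|x j| <= K)%N ->
  (`|t| <= K * `|x j| ^ d)%N ->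
  exists2 b : coefvec d n, (forall m, `|b m| <= C * K)%N & form_eval b x = t.
Proof.
elim: d => [|d [C IH]].
  exists 1%N => x j K t _ _ _; rewrite expn0 muln1 => tK.
  exists [ffun=> t] => [m|]; first by rewrite ffunE mul1n.
  rewrite /form_eval (eq_bigr (fun=> t)) ?sumr_const ?card_Mon0 // => m _.
  by rewrite ffunE big1 ?mulr1 // => i _; rewrite [val m i]ord1 expr0.
exists (n.+1 * #|Mon d n| * (C * n.+1))%N => x j K t xP xj jK tK.
have xj0 : (0 < `|x j|)%N.
  by have [i] := primitive_neq0 xP; rewrite -absz_gt0 => /leq_trans; apply; exact: xj.
have [||c cK <-] := @linear_representation n x j (K * `|x j| ^ d) t xP xj.
- by apply: (leq_trans jK); rewrite leq_pmulr // expn_gt0 xj0.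
- by rewrite -mulnA -expnSr.
have /choice [b bP] : forall i, exists b : coefvec d n,
    (forall m, `|b m| <= C * (n.+1 * K))%N /\ form_eval b x = c i.
  move=> i; have [||||b ? ?] := IH x j (n.+1 * K)%N (c i); rewrite -?mulnA //; last by exists b.
  by apply: (leq_trans jK); rewrite leq_pmull.
exists (linear_combination b) => [m|].
  rewrite -!mulnA mulnA; apply: linear_combination_le => i m'.
  by have [+ _] := bP i; apply.
rewrite form_eval_linear_combination; apply: eq_bigr => i _.
by have [_ ->] := bP i.
Qed.

(** * Forms vanishing at one given point *)

Lemma leq_wexp2r (a b e : nat) : (a <= b)%N -> (a ^ e <= b ^ e)%N.
Proof. by case: e => // e ab; rewrite leq_exp2r. Qed.

Lemma form_evalD (d n : nat) (a b : coefvec d n) (x : {ffun 'I_n.+1 -> int}) :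
  form_eval [ffun m => a m + b m] x = form_eval a x + form_eval b x.
Proof.
by rewrite /form_eval -big_split /=; apply: eq_bigr => m _; rewrite ffunE mulrDl.
Qed.

(** The shifts [a + b t], for [a] vanishing at [x] and [t < T], are pairwise distinct: evaluation at
    [x] recovers [t], and then [a]. They all lie in the cube of size [C.+1 * K]. *)
Lemma count_forms_through_point (d n : nat) : exists C : nat,
  forall (x : {ffun 'I_n.+1 -> int}) (j : 'I_n.+1) (K : nat),
  primitive_vec x -> (forall i, `|x i| <= `|x j|)%N -> (0 < `|x j| <= K)%N ->
  (count (fun a => form_eval a x == 0) (cube (Mon d n) K) * (K * `|x j| ^ d)
   <= C * K ^ #|Mon d n|)%N.
Proof.
have [C HC] := form_representation d n.
(* The side [2 * (C.+1 * K) + 1] of the larger cube is at most [(2 * C.+1).+1 * K], as [K] is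
   positive. *)
exists ((2 * C.+1).+1 ^ #|Mon d n|)%N => x j K xP xj /andP[xj0 jK].
set T := (K * _)%N.
have /choice [b bP] : forall t : nat, exists b : coefvec d n,
    (t < T)%N -> (forall m, `|b m| <= C * K)%N /\ form_eval b x = t%:Z.
  (* The zero form is a dummy value outside the range, so that [b] is defined on all of [nat]. *)
  move=> t; have [tT|tT] := ltnP t T; last by exists [ffun=> 0].
  by have [|b ? ?] := HC x j K t%:Z xP xj jK; [exact: ltnW|exists b].
pose s := [seq a <- cube (Mon d n) K | form_eval a x == 0].
pose shift (a : coefvec d n) (t : nat) : coefvec d n := [ffun m => a m + b t m].
have sP a : a \in s -> form_eval a x = 0 /\ forall m, (`|a m| <= K)%N.
  by rewrite mem_filter mem_cube => /andP[/eqP ? /forallP].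
rewrite -expnMn -size_filter -/s -[T](size_iota 0) -(size_allpairs shift).
apply: (@leq_trans (size (cube (Mon d n) (C.+1 * K)))).
  apply: uniq_leq_size.
    apply: allpairs_uniq; rewrite ?filter_uniq ?cube_uniq ?iota_uniq //.
    move=> _ _ /allpairsP[[a t] /= [/sP[a0 _] tT ->]]
           /allpairsP[[a' t'] /= [/sP[a'0 _] t'T ->]] /= e.
    have tt : t = t'.
      have := congr1 (fun c : coefvec d n => form_eval c x) e.
      rewrite !form_evalD a0 a'0 !add0r.
      move: tT t'T; rewrite !mem_iota /= add0n => tT t'T.
      by have [_ ->] := bP t tT; have [_ ->] := bP t' t'T; case.
    rewrite -tt in e *; congr (_, _); apply/ffunP => m.
    by have := congr1 (fun c : coefvec d n => c m) e; rewrite !ffunE => /addIr.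
  move=> _ /allpairsP[[a t] /= [/sP[_ aK] tT ->]].
  rewrite mem_cube; apply/forallP => m; rewrite ffunE.
  move: tT; rewrite mem_iota /= add0n => /bP[/(_ m) + _]; have := aK m.
  by rewrite mulSn; move: (a m) (b t m) (C * K)%N => u v w; lia.
rewrite size_cube; apply: leq_wexp2r; have : (0 < K)%N := leq_trans xj0 jK; nia.
Qed.

(** * Summation over the points of bounded size *)

Lemma expnD_le (a b n : nat) : ((a + b) ^ n.+1 <= a ^ n.+1 + n.+1 * b * (a + b) ^ n)%N.
Proof.
elim: n => [|n IH]; first by rewrite !expn1 expn0; lia.
have as_le : (a * (a + b) ^ n <= (a + b) ^ n.+1)%N by rewrite expnS leq_mul2r leq_addr orbT.
rewrite [leqLHS]expnS [(a ^ n.+2)%N]expnS.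
move: IH as_le; set p := (a ^ n.+1)%N; set q := ((a + b) ^ n.+1)%N; set s := ((a + b) ^ n)%N.
move=> /(leq_mul (leqnn a)) qp /(leq_mul (leqnn (n.+1 * b))) sq.
lia.
Qed.

Lemma cube_subset (I : finType) (k l : nat) :
  (k <= l)%N -> {subset cube I k <= cube I l}.
Proof.
move=> kl a; rewrite !mem_cube => /forallP ak; apply/forallP => i.
exact: leq_trans (ak i) kl.
Qed.

(** The difference of two consecutive cube sizes, [(2X+3)^(n+1) - (2X+1)^(n+1)], is at most
    [2(n+1)(2X+3)^n], and [2X+3 <= 3(X+1)]. *)
Lemma count_shell (n X : nat) :
  (count (fun x => x \notin cube 'I_n.+1 X) (cube 'I_n.+1 X.+1) <= n.+1 * 2 * 3 ^ n * X.+1 ^ n)%N.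
Proof.
have := count_predC (mem (cube 'I_n.+1 X)) (cube 'I_n.+1 X.+1).
have : (size (cube 'I_n.+1 X) <= count (mem (cube 'I_n.+1 X)) (cube 'I_n.+1 X.+1))%N.
  rewrite -size_filter; apply: uniq_leq_size (cube_uniq _ _) _ => x xX.
  by rewrite mem_filter /= xX (@cube_subset _ X).
rewrite !size_cube card_ord.
have := expnD_le (2 * X).+1 2 n; rewrite (_ : (2 * X).+1 + 2 = (2 * X.+1).+1)%N; last by lia.
have : ((2 * X.+1).+1 ^ n <= 3 ^ n * X.+1 ^ n)%N by rewrite -expnMn; apply: leq_wexp2r; lia.
set u := ((2 * X.+1).+1 ^ n)%N; set v := (3 ^ n * _)%N => uv.
rewrite -mulnA -/v.
set w := count _ _; set w' := count _ _.
have -> : w' = count (predC (mem (cube 'I_n.+1 X))) (cube 'I_n.+1 X.+1) by [].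
nia.
Qed.

Lemma count_has_le (S T : Type) (P : S -> T -> bool) (s : seq S) (t : seq T) :
  (count (fun a => has (P a) t) s <= \sum_(x <- t) count (P^~ x) s)%N.
Proof.
elim: t => [|x t IH]; first by rewrite big_nil /= count_pred0.
rewrite big_cons; apply: leq_trans (leq_add (leqnn _) IH).
by rewrite -count_predUI; apply: leq_trans (leq_addr _ _).
Qed.

Definition has_zero_in (d n : nat) (s : seq {ffun 'I_n.+1 -> int}) (a : coefvec d n) : bool :=
  has (fun x => primitive_vec x && (form_eval a x == 0)) s.

(** Induction on [X], one shell at a time: the shell of size [X.+1] has [O(X.+1 ^ n)] points, and
    each contributes [O(K ^ N / (K * X.+1 ^ d))] forms, where [N] is the number of monomials. *)
Lemma count_forms_with_small_zero (d n : nat) : (d <= n)%N -> exists C : nat,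
  forall X K : nat, (X <= K)%N ->
  (count (has_zero_in (cube 'I_n.+1 X)) (cube (Mon d n) K) * K
   <= C * X ^ (n.+1 - d) * K ^ #|Mon d n|)%N.
Proof.
move=> dn; have [C HC] := count_forms_through_point d n.
exists (C * (n.+1 * 2 * 3 ^ n))%N; elim=> [|X IH] K XK.
  (* The only point of the cube of size 0 is the zero vector, which is not primitive. *)
  rewrite (eq_in_count (a2 := pred0)) ?count_pred0 ?mul0n // => a _.
  apply/negbTE/hasPn => x; rewrite mem_cube => /forallP x0; apply/negP => /andP[/primitive_neq0[i]].
  by rewrite -absz_gt0 ltnNge x0.
pose shell := [seq x <- cube 'I_n.+1 X.+1 | (x \notin cube 'I_n.+1 X) && primitive_vec x].
have le1 : (count (@has_zero_in d n (cube 'I_n.+1 X.+1)) (cube (Mon d n) K) <=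
  count (@has_zero_in d n (cube 'I_n.+1 X)) (cube (Mon d n) K) +
  count (fun a => has (fun x => form_eval a x == 0) shell) (cube (Mon d n) K))%N.
  rewrite -count_predUI; apply: leq_trans (leq_addr _ _).
  apply: sub_count => a /hasP[x xX /andP[xP ax]] /=.
  have [xX'|xX'] := boolP (x \in cube 'I_n.+1 X).
    by apply/orP; left; apply/hasP; exists x => //; rewrite xP.
  by apply/orP; right; apply/hasP; exists x => //; rewrite mem_filter xX' xP.
have le2 : (count (fun a => has (fun x => form_eval a x == 0%R) shell) (cube (Mon d n) K) * K
   <= C * (n.+1 * 2 * 3 ^ n) * X.+1 ^ (n - d) * K ^ #|Mon d n|)%N.
  (* This factor supplies the [|x j| ^ d] of the bound at one point: the largest coordinate on the
     shell is exactly [X.+1]. *)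
  rewrite -(@leq_pmul2r (X.+1 ^ d)) ?expn_gt0 //.
  apply: (@leq_trans (\sum_(x <- shell) C * K ^ #|Mon d n|)%N).
    rewrite -mulnA; apply: leq_trans (leq_mul (count_has_le _ _ _) (leqnn _)) _.
    rewrite big_distrl /= big_seq [leqRHS]big_seq; apply: leq_sum => x.
    rewrite mem_filter mem_cube [x \in cube _ X.+1]mem_cube.
    move=> /andP[/andP[/forallPn[i xi] xP] /forallP xX].
    have [j xj] : {j | forall i, (`|x i| <= `|x j|)%N}.
      case: (@arg_maxnP _ ord0 predT (fun i => `|x i|%N) isT) => j _ jP.
      by exists j => k; apply: jP.
    have xjX : `|x j|%N = X.+1.
      by apply/eqP; rewrite eqn_leq xX /=; apply: leq_trans (xj i); rewrite ltnNge.
    by rewrite -xjX; apply: HC; rewrite ?xjX.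
  rewrite big_const_seq count_predT iter_addn_0 size_filter.
  have : (count (fun x => (x \notin cube 'I_n.+1 X) && primitive_vec x) (cube 'I_n.+1 X.+1)
          <= n.+1 * 2 * 3 ^ n * X.+1 ^ n)%N.
    by apply: leq_trans (count_shell n X); apply: sub_count => x /andP[].
  rewrite (_ : X.+1 ^ n = X.+1 ^ (n - d) * X.+1 ^ d)%N; last by rewrite -expnD subnK.
  move=> /(leq_mul (leqnn (C * K ^ #|Mon d n|))) /leq_trans; apply.
  move: (n.+1 * 2 * 3 ^ n)%N (X.+1 ^ (n - d))%N (X.+1 ^ d)%N (K ^ _)%N => u v w z.
  by apply: eq_leq; ring.
have := IH K (ltnW XK); rewrite subSn // !expnS.
have : (X ^ (n - d) <= X.+1 ^ (n - d))%N by apply: leq_wexp2r.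
move: le1 le2.
set c := (C * _)%N; set k := (K ^ _)%N.
set a := count _ _; set b := count _ _; set f := count _ _.
set p := (X ^ _)%N; set q := (X.+1 ^ _)%N.
move=> le1 le2 pq le3.
(* The induction closes by [X * X^(n-d) + (X+1)^(n-d) <= (X+1) * (X+1)^(n-d)]. *)
apply: (@leq_trans (c * (X * p) * k + c * q * k)).
  by apply: leq_trans (leq_add le3 le2); rewrite -mulnDl leq_mul2r le1 orbT.
by rewrite -mulnDl -mulnDr leq_mul2r leq_mul2l mulSn [(q + _)%N]addnC leq_add2r leq_mul2l pq !orbT.
Qed.

(** * Lower bound for the number of hypersurfaces *)

(** The pure powers [X_i^d] are [n+1] distinct monomials. This gives at least two coefficients, as
    the sum over common divisors requires. *)
Lemma card_Mon_gt (d n : nat) : (0 < d)%N -> (n < #|Mon d n|)%N.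
Proof.
case: d => // d _.
pose e (i : 'I_n.+1) : {ffun 'I_n.+1 -> 'I_d.+2} := [ffun j => if j == i then ord_max else ord0].
have eP i : (\sum_(j < n.+1) (e i j : nat) == d.+1)%N.
  rewrite (bigD1 i) //= ffunE eqxx big1 ?addn0 // => j /negbTE ji.
  by rewrite ffunE ji.
pose m (i : 'I_n.+1) : Mon d.+1 n :=
  @exist {ffun 'I_n.+1 -> 'I_d.+2} (fun e => \sum_(j < n.+1) (e j : nat) == d.+1)%N _ (eP i).
suff /leq_card : injective m by rewrite card_ord.
move=> i j /(congr1 (fun m : Mon d.+1 n => val m i : nat)) /=.
by rewrite !ffunE eqxx; case: eqP.
Qed.

Lemma card_multiples (k g : nat) : #|[pred i : 'I_k | (g %| i.+1)%N]| = (k %/ g)%N.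
Proof.
rewrite divn_count_dvd big_add1 /= big_mkord -sum1_card big_mkcond /=.
by apply: eq_bigr => i _; rewrite inE; case: (_ %| _)%N.
Qed.

(** Telescoping through [(u+1)^-2 <= u^-1 - (u+1)^-1], with equality at [m = 0]; hence the
    subtracted term. *)
Lemma sum_inv_sqr_le (m : nat) :
  \sum_(2 <= g < m.+3) ((g%:R : rat) ^- 2) <= 3 / 4 - (m.+2%:R)^-1.
Proof.
elim: m => [|m IH]; first by rewrite big_nat1; lra.
rewrite big_nat_recr //=; apply: le_trans (lerD IH (lexx _)) _.
have m2 : (m.+2%:R : rat) > 0 by rewrite ltr0n.
have -> : (m.+3%:R : rat) = m.+2%:R + 1 by rewrite -addn1 natrD.
move: (m.+2%:R) m2 => u u0.
rewrite -subr_ge0.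
have -> : 3 / 4 - (u + 1)^-1 - (3 / 4 - u^-1 + (u + 1) ^- 2) = (u * (u + 1) ^+ 2)^-1.
  by field; rewrite ?gt_eqF // ?addr_gt0.
by rewrite invr_ge0 mulr_ge0 ?exprn_ge0 ?addr_ge0 // ltW.
Qed.

Lemma sum_divn_exp_le (k N : nat) : (1 < N)%N ->
  (4 * \sum_(2 <= g < k.+1) (k %/ g) ^ N <= 3 * k ^ N)%N.
Proof.
move=> N1; case: k => [|[|m]].
- by rewrite big_geq.
- by rewrite big_geq.
set k := m.+2; rewrite -(ler_nat rat) !natrM natr_sum natrX.
have kg g : (2 <= g < k.+1)%N -> (((k %/ g) ^ N)%N%:R : rat) <= k%:R ^+ N * g%:R ^- 2.
  move=> /andP[g2 _]; have g0 : (0 : rat) < g%:R ^+ 2 by rewrite exprn_gt0 // ltr0n; lia.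
  rewrite -(ler_pM2r g0) mulfVK ?gt_eqF // -!natrX -natrM ler_nat.
  rewrite -(subnK N1) !expnD -mulnA -expnMn leq_mul //.
    by apply: leq_wexp2r; exact: leq_div.
  by apply: leq_wexp2r; exact: leq_divM.
apply: (@le_trans _ _ (4 * (k%:R ^+ N * (3 / 4)))); last by lra.
rewrite ler_wpM2l //; apply: le_trans (ler_sum_nat kg) _.
rewrite -mulr_sumr ler_wpM2l ?exprn_ge0 // (le_trans (sum_inv_sqr_le m)) //.
by rewrite gerBl invr_ge0 ler0n.
Qed.

Lemma dvdz_biggcd (I : finType) (a : {ffun I -> int}) (i : I) :
  ((\big[gcdz/0%Z]_j a j) %| a i)%Z.
Proof.
have : i \in index_enum I by rewrite mem_index_enum.
elim: (index_enum I) => // j r IH; rewrite big_cons inE => /orP[/eqP ->|/IH].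
  exact: dvdz_gcdl.
by apply: dvdz_trans; exact: dvdz_gcdr.
Qed.

Lemma card_count (T : finType) (P : pred T) : #|P| = count P (enum T).
Proof. by rewrite cardE {1}/enum_mem size_filter -enumT. Qed.

(** A non-primitive vector with entries in [[1, k]] has all entries divisible by some [g] with
    [2 <= g <= k]. For each [g] there are [(k %/ g) ^ #|I|] such vectors, in total at most three
    quarters of all. *)
Lemma card_primitive_positive (I : finType) (k : nat) : (1 < #|I|)%N ->
  (k ^ #|I| <= 4 * #|[pred f : {ffun I -> 'I_k} |
                      primitive_vec [ffun i => (f i).+1%:Z]]|)%N.
Proof.
move=> I1; set P := [pred f | _].
have := cardC P; rewrite card_ffun card_ord.
suff : (#|[predC P]| <= \sum_(2 <= g < k.+1) (k %/ g) ^ #|I|)%N.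
  move: (sum_divn_exp_le k I1).
  by move: (\sum_(_ <= _ < _) _)%N (k ^ _)%N #|P| #|[predC P]| => s p u v; lia.
pose Q (f : {ffun I -> 'I_k}) g := [forall i, (g %| (f i).+1)%N].
apply: (@leq_trans (count (fun f => has (Q f) (index_iota 2 k.+1)) (enum {: {ffun I -> 'I_k}}))).
  rewrite card_count; apply: sub_count => f; rewrite !inE => fP.
  have /card_gt0P[i _] : (0 < #|I|)%N by exact: ltnW.
  set a : {ffun I -> int} := [ffun i => (f i).+1%:Z] in fP.
  pose g := `|\big[gcdz/0%Z]_j a j|%N.
  have gP j : (g %| (f j).+1)%N by have := dvdz_biggcd a j; rewrite [a j]ffunE.
  apply/hasP; exists g; last by apply/forallP.
  have g0 : (0 < g)%N by rewrite lt0n; apply/eqP => g0; have := gP i; rewrite g0 dvd0n.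
  have g1 : g != 1%N.
    apply: contra fP => /eqP g1; rewrite /primitive_vec.
    have : 0 <= \big[gcdz/0%Z]_j a j by elim/big_ind: _ => //; rewrite /a => *; rewrite ffunE.
    by move: g1; rewrite /g; case: (\big[_/_]_j _) => [[|[]]|].
  have := dvdn_leq (ltn0Sn _) (gP i); have := ltn_ord (f i); rewrite mem_index_iota; lia.
apply: leq_trans (count_has_le _ _ _) _; apply: leq_sum => g _.
rewrite -card_multiples -card_ffun_on -card_count.
by apply: subset_leq_card; apply/fintype.subsetP => f /forallP fg; apply/ffun_onP => i; rewrite inE.
Qed.

Lemma norm_le_enorm (R : realType) (I : finType) (a : {ffun I -> int}) (i : I) :
  (`|a i|%N)%:R <= enorm R a.
Proof.
rewrite natr_absz intr_norm -sqrtr_sqr ler_wsqrtr // (bigD1 i) //=.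
by rewrite lerDl sumr_ge0 // => j _; exact: sqr_ge0.
Qed.

Lemma enorm_le (R : realType) (I : finType) (a : {ffun I -> int}) (k : nat) :
  (forall i, `|a i| <= k)%N -> enorm R a <= (#|I| * k)%:R.
Proof.
move=> ak; rewrite -[leRHS]ger0_norm // -sqrtr_sqr ler_wsqrtr //.
apply: (@le_trans _ _ (\sum_(i : I) k%:R ^+ 2)).
  apply: ler_sum => i _; rewrite -real_normK ?num_real // -intr_norm -natr_absz.
  by rewrite lerXn2r ?nnegrE // ler_nat.
rewrite sumr_const natrM exprMn -[leLHS]mulr_natl ler_wpM2r ?sqr_ge0 //.
by rewrite -natrX ler_nat; case: #|I| => // m; rewrite expnS leq_pmulr.
Qed.

(** Vectors with entries in [[1, K %/ N]] have norm at most [K <= A], and are normalized because all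
    their coordinates are positive; at least a quarter of them are primitive. *)
Lemma countV_lower_bound (R : realType) (d n : nat) : (0 < d)%N -> (0 < n)%N ->
  exists2 c : nat, (0 < c)%N & forall A : R, #|Mon d n|%:R <= A ->
  (Num.truncn A ^ #|Mon d n| <= c * countV (fun _ : coefvec d n => true) A)%N.
Proof.
move=> d0 n0; have := card_Mon_gt n d0; set N := #|_| => nN.
have N0 : (0 < N)%N by lia.
(* The 4 is the primitive proportion, and [2 * N] comes from [K < k.+1 * N <= 2 * N * k], where
   [k = K %/ N] is positive since [A >= N]. *)
exists ((2 * N) ^ N * 4)%N; first by rewrite muln_gt0 expn_gt0; lia.
move=> A NA; have A0 : 0 <= A by exact: le_trans NA.
set K := Num.truncn A; have NK : (N <= K)%N by rewrite truncn_ge_nat.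
pose k := (K %/ N)%N.
have kK : (k * N <= K)%N := leq_divM K N.
apply: (@leq_trans ((2 * N) ^ N * k ^ N)%N).
  rewrite -expnMn; apply: leq_wexp2r.
  have : (0 < k)%N by rewrite divn_gt0.
  by have := ltn_ceil K N0; rewrite -/k; nia.
rewrite -mulnA leq_mul2l; apply/orP; right.
apply: leq_trans (card_primitive_positive _ _) _; first by rewrite -/N; lia.
rewrite leq_mul2l /= countVE -size_filter cardE.
pose h (f : {ffun Mon d n -> 'I_k}) : coefvec d n := [ffun i => (f i).+1%:Z].
rewrite -(size_map h); apply: uniq_leq_size.
  rewrite map_inj_uniq ?enum_uniq // => f g /ffunP fg; apply/ffunP => i; apply: val_inj.
  by have := fg i; rewrite !ffunE => -[].
move=> _ /mapP[f + ->]; rewrite mem_enum inE => fP.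
have hk m : (`|h f m| <= k)%N by rewrite ffunE /=; exact: ltn_ord.
rewrite mem_filter mem_cube /= !andbT /is_hyp fP /= -andbA; apply/and3P; split.
- rewrite /normalized; case: pickP => [m _|hz]; first by rewrite ffunE.
  have /card_gt0P[m _] := N0.
  by have := hz m; rewrite ffunE.
- apply: le_trans (enorm_le R hk) _; apply: (@le_trans _ _ K%:R); last by rewrite truncn_le.
  by rewrite ler_nat mulnC.
- by apply/forallP => m; apply: leq_trans (hk m) _; exact: leq_div.
Qed.

(** * From heights to small zeros, and the limit *)

(* The slack [1] spares proving that the infimum is attained; [psi + 1] is still [o(u)]. *)
Lemma Mfrak_le_point (R : realType) (d n : nat) (a : coefvec d n) (u : R) :
  (Mfrak R a <= u%:E)%E -> exists x : {ffun 'I_n.+1 -> int},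
    [/\ primitive_vec x, form_eval a x = 0 & Hpt R d x < u + 1].
Proof.
move=> Mu; have /ereal_inf_lt[_ [x [xP ax] <-]] : (Mfrak R a < (u + 1)%:E)%E.
  by apply: le_lt_trans Mu _; rewrite lte_fin ltrDl.
by rewrite lte_fin => Hx; exists x.
Qed.

(** [X] is the integer part of the [e]-th root of [Y]; it converts a height bound into a cube of
    points. *)
Lemma floor_root (e Y : nat) : (0 < e)%N ->
  exists2 X : nat, (X ^ e <= Y)%N & forall m : nat, (m ^ e <= Y)%N -> (m <= X)%N.
Proof.
move=> e0; have mY m : (m ^ e <= Y)%N -> (m <= Y)%N.
  by case: m => // m; apply: leq_trans; rewrite -[leqLHS]expn1 leq_pexp2l.
have ex0 : exists m, (m ^ e <= Y)%N by exists 0%N; rewrite exp0n.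
by have [X] := ex_maxnP ex0 mY; exists X.
Qed.

(* [psi] may be unbounded on bounded sets, so the finitely many forms of norm below [u0] are
   all counted as bad. *)
Lemma bad_forms_bound (R : realType) (d n : nat) (psi : R -> R) (eps u0 A : R) (U X K : nat) :
  (0 < n.+1 - d)%N -> u0 <= U.+1%:R ->
  (forall u, u0 <= u -> psi u <= eps / 2 * u) -> 1 <= eps / 2 * A -> 0 <= eps ->
  (forall m : nat, m%:R ^+ (n.+1 - d) <= eps * A -> (m <= X)%N) ->
  (count (fun a : coefvec d n => is_hyp a && (enorm R a <= A)%R
            && ~~ ((psi (enorm R a))%:E < Mfrak R a)%E) (cube (Mon d n) K)
   <= size (cube (Mon d n) U) + count (has_zero_in (cube 'I_n.+1 X)) (cube (Mon d n) K))%N.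
Proof.
move=> e0 u0U psile A1 eps0 mX.
apply: (@leq_trans (count (mem (cube (Mon d n) U)) (cube (Mon d n) K) +
                    count (has_zero_in (cube 'I_n.+1 X)) (cube (Mon d n) K))); last first.
  rewrite leq_add2r -size_filter; apply: uniq_leq_size; rewrite ?filter_uniq ?cube_uniq //.
  by move=> a; rewrite mem_filter => /andP[].
rewrite -count_predUI; apply: leq_trans (leq_addr _ _).
apply: sub_count => a /andP[/andP[_ aA]]; rewrite -leNgt => /Mfrak_le_point[x [xP ax Hx]] /=.
have [au|ua] := ltP (enorm R a) u0.
  apply/orP; left; rewrite mem_cube; apply/forallP => m; rewrite -ltnS -(ltr_nat R).
  by apply: le_lt_trans (norm_le_enorm R a m) _; apply: lt_le_trans au u0U.
apply/orP; right; apply/hasP; exists x; last by rewrite xP ax eqxx.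
rewrite mem_cube; apply/forallP => i; apply: mX.
apply: (@le_trans _ _ (Hpt R d x)).
  by rewrite lerXn2r ?nnegrE ?sqrtr_ge0 // norm_le_enorm.
(* One half of [eps * A] bounds [psi], the other half absorbs the slack 1. *)
have := psile _ ua; have : eps / 2 * enorm R a <= eps / 2 * A by rewrite ler_wpM2l // divr_ge0.
lra.
Qed.

Theorem theorem1 (R : realType) (d n : nat) (psi : R -> R)
  (hd : (2 <= d)%N) (hn : (d <= n)%N) (hdn : (d, n) <> (2%N, 2%N))
  (hpos : forall u : R, 0 < u -> 0 < psi u)
  (ho : forall eps : R, 0 < eps -> \forall u \near +oo, `|psi u| <= eps * `|u|) :
  (fun A : R =>
     ((countV (fun a : coefvec d n => (psi (enorm R a))%:E < Mfrak R a)%E A)%:R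
      / (countV (fun _ : coefvec d n => true) A)%:R : R)) @ +oo --> (1 : R).
Proof.
have [C HC] := count_forms_with_small_zero hn.
have [c c0 Hc] := @countV_lower_bound R d n (ltnW hd) (leq_trans (ltnW hd) hn).
have N0 : (0 < #|Mon d n|)%N by apply: leq_trans (card_Mon_gt n (ltnW hd)).
have e0 : (0 < n.+1 - d)%N by rewrite subn_gt0 ltnS.
apply/cvgrPdist_le => r r0.
(* Chosen so that the final bound [2 * C.+1 * c * eps * T] for the forms with a small zero is at
   most [r / 2 * T]. *)
pose D : R := 4 * C.+1%:R * c%:R.
have D0 : 0 < D by rewrite !mulr_gt0 // ltr0n.
pose eps := Num.min 1 (r / D).
have eps0 : 0 < eps by rewrite lt_min ltr01 divr_gt0.
have epsD : eps * D <= r by rewrite -ler_pdivlMr // ge_min lexx orbT.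
have eps1 : eps <= 1 by rewrite ge_min lexx.
have [u1 [_ Hu1]] := ho (eps / 2) (divr_gt0 eps0 (ltr0n _ 2)).
pose u0 := Num.max 0 u1 + 1.
have psile u : u0 <= u -> psi u <= eps / 2 * u.
  move=> u0u; have u00 : 0 <= u by apply: le_trans u0u; rewrite addr_ge0 // le_max lexx.
  have u1u : u1 < u by apply: lt_le_trans u0u; rewrite ltr_pwDr // le_max lexx orbT.
  by have := Hu1 u u1u; rewrite (ger0_norm u00); apply: le_trans; exact: ler_norm.
pose U := Num.truncn u0.
pose S := size (cube (Mon d n) U).
near=> A.
have NA : (#|Mon d n|)%:R <= A by near: A; apply: nbhs_pinfty_ge; exact: num_real.
have A1 : 1 <= A by apply: le_trans NA; rewrite ler1n.
have epsA : 1 <= eps / 2 * A.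
  rewrite -ler_pdivrMl ?divr_gt0 //; near: A; apply: nbhs_pinfty_ge; exact: num_real.
(* Together with [A <= 2 * K <= 2 * c * T], this makes the [S] forms of small norm at most
   [r / 2 * T]. *)
have SA : S%:R * c%:R * 4 / r <= A by near: A; apply: nbhs_pinfty_ge; exact: num_real.
set K := Num.truncn A.
have A0 : 0 <= A by exact: le_trans A1.
have K0 : (0 < K)%N by rewrite truncn_gt0.
have KA : A <= 2 * K%:R.
  have := truncnS_gt A; rewrite -/K -addn1 natrD.
  have : (1 : R) <= K%:R by rewrite ler1n.
  lra.
set P := fun a : coefvec d n => _.
set T := countV (fun _ : coefvec d n => true) A.
(* The bad forms: the ratio differs from 1 by exactly [B / T]. *)
pose B := count (fun a : coefvec d n => is_hyp a && (enorm R a <= A) && ~~ P a) (cube (Mon d n) K).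
have TE : (countV P A + B)%N = T.
  rewrite /T !countVE -count_predUI.
  rewrite (eq_count (a2 := fun a => is_hyp a && (enorm R a <= A) && true)).
    rewrite [X in (_ + X)%N](eq_count (a2 := pred0)) ?count_pred0 ?addn0 // => a /=.
    by case: (P a); rewrite /= ?andbF // ?andbT.
  by move=> a /=; case: (P a); rewrite /= ?andbF ?andbT ?orbF.
have [X XY mX] := floor_root (Num.truncn (eps * A)) e0.
have epsA0 : 0 <= eps * A by rewrite mulr_ge0 // ltW.
(* Here [eps <= 1] is used: [X] is at most its power, hence at most the integer part of
   [eps * A]. *)
have XK : (X <= K)%N.
  apply: (@leq_trans (X ^ (n.+1 - d))%N).
    by case: (X) => // m; rewrite -[leqLHS]expn1 leq_pexp2l.
  by apply: leq_trans XY _; apply: le_truncn; rewrite ler_piMl.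
have BS : (B <= S + count (has_zero_in (cube 'I_n.+1 X)) (cube (Mon d n) K))%N.
  apply: (@bad_forms_bound R d n psi eps u0) => //.
  - by apply: ltW; exact: truncnS_gt.
  - exact: ltW.
  - by move=> m mA; apply: mX; rewrite truncn_ge_nat // natrX.
have TK := Hc A NA; rewrite -/K -/T in TK.
have T0 : (0 < T)%N.
  have : (0 < c * T)%N by apply: leq_trans TK; rewrite expn_gt0 K0.
  by rewrite muln_gt0 => /andP[].
have BK := HC X K XK.
set N := #|_| in TK BK.
have KN : (K <= K ^ N)%N by rewrite -[leqLHS]expn1 leq_pexp2l.
have T0' : 0 < T%:R :> R by rewrite ltr0n.
have Tn0 : T%:R != 0 :> R by rewrite gt_eqF.
have -> : 1 - (countV P A)%:R / T%:R = B%:R / T%:R :> R.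
  by rewrite -{1}(divff Tn0) -mulrBl -TE natrD addrAC subrr add0r.
rewrite ger0_norm ?divr_ge0 // ler_pdivrMr //.
have XA : (X ^ (n.+1 - d))%:R <= eps * A by rewrite -truncn_ge_nat.
move: BS BK; set b := count _ _ => BS BK.
have TR : (K ^ N)%:R <= c%:R * T%:R :> R by rewrite -natrM ler_nat.
have bT : b%:R <= r / 2 * T%:R.
  have KR : 0 < K%:R :> R by rewrite ltr0n.
  rewrite -(ler_pM2r KR); apply: (@le_trans _ _ (C%:R * (X ^ (n.+1 - d))%:R * (K ^ N)%:R)).
    by rewrite -!natrM ler_nat.
  (* Uses [X ^ (n.+1 - d) <= eps * A <= 2 * eps * K] and [K ^ N <= c * T]; the common factor [K]
     then cancels. *)
  apply: (@le_trans _ _ (C.+1%:R * (eps * (2 * K%:R)) * (c%:R * T%:R))).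
    apply: ler_pM => //.
    apply: ler_pM => //; first by rewrite ler_nat.
    by apply: le_trans XA _; rewrite ler_wpM2l // ltW.
  have -> : C.+1%:R * (eps * (2 * K%:R)) * (c%:R * T%:R) = (eps * D) / 2 * T%:R * K%:R.
    by rewrite /D; field.
  by rewrite ler_wpM2r // ler_wpM2r // ler_wpM2r.
have ST : S%:R <= r / 2 * T%:R.
  have cR : 0 < c%:R :> R by rewrite ltr0n.
  have KN' : K%:R <= (K ^ N)%:R :> R by rewrite ler_nat.
  move: SA; rewrite ler_pdivrMr // => SA.
  have AT : A * r <= 2 * (c%:R * T%:R) * r.
    rewrite (ler_wpM2r (ltW r0)) // (le_trans KA) // ler_wpM2l //; exact: le_trans KN' TR.
  rewrite -(ler_pM2l cR).
  move: (le_trans SA AT); clear; lra.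
have : B%:R <= S%:R + b%:R :> R by rewrite -natrD ler_nat.
move: bT ST; clear; lra.
Unshelve. all: by end_near.
Qed.
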